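(* In the setting of the context, suppose the regularity assumption and the local worst-case oracle assumption hold, and fix $x\in\mathcal X$ (write $\ell_k(z)=\ell_k(x,z)$), $i\in[N]$, $1\le k_1<k_2\le K$, $b\in\mathbb R_+$ and a weight $\alpha\in\mathbb R_+^2$ with $\alpha_1+\alpha_2=1$. Let $$\Psi_i^{(k_1,k_2)}(\alpha,\beta)=\max_{v_1,v_2}\Big\{\alpha_1\ell_{k_1}(\hat z_i+v_1)+\alpha_2\ell_{k_2}(\hat z_i+v_2): v_j\in\mathbb R^m,\ \hat z_i+v_j\in\mathcal Z,\ \alpha_jc(\hat z_i+v_j,\hat z_i)\le\beta_j,\ j\in\{1,2\}\Big\}.$$ Then for any two budget allocations $\beta,\beta'\in\mathbb R_+^2$ with $\beta_1+\beta_2=\beta_1'+\beta_2'=b$, $$\Big|\Psi_i^{(k_1,k_2)}(\alpha,\beta)-\Psi_i^{(k_1,k_2)}(\alpha,\beta')\Big|\le2G_i|\beta_1-\beta_1'|^{1/p},$$ where $G_i:=\max_{k\in[K]}\max\{\|\xi\|_*:\xi\in\partial\ell_k(\hat z_i)\}$.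
   Context: Notation: $[n]=\{1,\dots,n\}$; $\mathcal P(\mathcal Z)$ is the set of Borel probability measures on $\mathcal Z$; $\|\cdot\|_*$ is the dual norm of the norm $\|\cdot\|$ below; $\partial\ell_k(\hat z_i)$ is the superdifferential of the concave function $\ell_k$ at $\hat z_i$. Setting. $\mathcal X\subseteq\mathbb R^n$, $\mathcal Z\subseteq\mathbb R^m$. A transportation cost $c:\mathcal Z\times\mathcal Z\to\mathbb R_+$ is lower semicontinuous, satisfies $c(z,z)=0$ for all $z$, and $c(\cdot,\hat z)$ is convex for every fixed $\hat z\in\mathcal Z$. The optimal transport discrepancy is $\mathrm{OT}_c(\mathbb P,\mathbb Q)=\min_{\gamma}\mathbb E_{(z,\hat z)\sim\gamma}[c(z,\hat z)]$ over couplings $\gamma$ of $\mathbb P$ and $\mathbb Q$. Given $\hat z_1,\dots,\hat z_N\in\mathcal Z$, let $\hat{\mathbb P}=\frac1N\sum_{i=1}^N\delta_{\hat z_i}$; given $\rho>0$, let $\mathcal P=\{\mathbb P\in\mathcal P(\mathcal Z):\mathrm{OT}_c(\mathbb P,\hat{\mathbb P})\le\rho\}$. Regularity assumption. (i) $\mathcal X$ is nonempty and convex; there exist $\mathbb Q_0\in\mathcal P$ and $x_0\in\mathcal X$ such that $x\mapsto\mathbb E_{z\sim\mathbb Q_0}[\ell(x,z)]$ is inf-compact on $\mathcal X$ (all sublevel sets are compact) and $\mathbb E_{z\sim\mathbb Q_0}[\ell(x_0,z)]>-\infty$; $\mathcal Z$ is nonempty, closed and convex. (ii) $\ell(x,z)=\max_{k\in[K]}\ell_k(x,z)$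 with $K\ge2$, where each $\ell_k:\mathbb R^n\times\mathbb R^m\to\mathbb R$ is real-valued, convex in its first and concave in its second argument. (iii) There exist a norm $\|\cdot\|$ on $\mathbb R^m$ and $p\ge1$ with $c(z,\hat z)\ge\|z-\hat z\|^p$ for all $z,\hat z\in\mathcal Z$; moreover, if $p=1$, then for every $x\in\mathcal X$ there exist $g>0$, $\hat z_0\in\mathcal Z$ and $r\in[0,1)$ such that $\ell(x,z)\le g[1+\|z-\hat z_0\|^r]$ for all $z\in\mathcal Z$. Local worst-case oracle assumption. For any $k\in[K]$, $\hat z\in\mathcal Z$, radius $u\ge0$ and accuracy $\epsilon>0$ there is an algorithm that returns $\hat v\in\mathbb R^m$ with $\hat z+\hat v\in\mathcal Z$, $c(\hat z+\hat v,\hat z)\le u$, together with $\hat L=\ell_k(\hat z+\hat v)\ge\max\{\ell_k(\hat z+v):v\in\mathbb R^m,\hat z+v\in\mathcal Z,c(\hat z+v,\hat z)\le u\}-\epsilon$. *)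

(* Defs.v *)
From HB Require Import structures.
From mathcomp Require Import all_boot all_order all_algebra.
From mathcomp Require Import all_classical all_reals all_analysis.
Set Implicit Arguments.
Unset Strict Implicit.
Unset Printing Implicit Defensive.

Import Order.TTheory GRing.Theory Num.Theory.
Import numFieldNormedType.Exports.

Local Open Scope classical_set_scope.
Local Open Scope ring_scope.

Definition is_max (R : realType) (S : set R) (M : R) : Prop :=
  S M /\ ubound S M.

Record is_norm (R : realType) (m : nat) (nrm : 'rV[R]_m -> R) : Prop := {
  is_norm_ge0 : forall z, 0 <= nrm z ;
  is_norm_eq0 : forall z, nrm z = 0 -> z = 0 ;
  is_normZ : forall (a : R) z, nrm (a *: z) = `|a| * nrm z ;
  is_normD : forall z w, nrm (z + w) <= nrm z + nrm w }.

Definition dot (R : realType) (m : nat) (u v : 'rV[R]_m) : R :=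
  \sum_(j < m) u 0 j * v 0 j.

Definition dual_norm (R : realType) (m : nat) (nrm : 'rV[R]_m -> R)
    (xi : 'rV[R]_m) : R :=
  sup [set dot xi z | z in [set z | nrm z <= 1]].

Definition superdifferential (R : realType) (m : nat) (f : 'rV[R]_m -> R)
    (z0 : 'rV[R]_m) : set 'rV[R]_m :=
  [set xi | forall z, f z <= f z0 + dot xi (z - z0)].

Definition concave_function (R : realType) (m : nat) (f : 'rV[R]_m -> R) :=
  @convex_function R 'rV[R]_m setT (fun z => - f z).

Notation borel_rV R m := (g_sigma_algebraType (@open 'rV[R]_m)).

(* Cost functions are total on R^m x R^m, but only their values on Z x Z are
   constrained or used.  Lower semicontinuity is relative to Z x Z. *)
Record transport_cost (R : realType) (m : nat) (Z : set 'rV[R]_m)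
    (c : 'rV[R]_m -> 'rV[R]_m -> R) : Prop := {
  cost_ge0 : forall z zh, Z z -> Z zh -> 0 <= c z zh ;
  cost_lsc : lower_semicontinuous
    (fun w : subspace (Z `*` Z) =>
       (c (w : 'rV[R]_m * 'rV[R]_m).1 (w : 'rV[R]_m * 'rV[R]_m).2)%:E) ;
  cost_diag : forall z, Z z -> c z z = 0 ;
  cost_convex : forall zh, Z zh -> @convex_function R 'rV[R]_m Z (c^~ zh) }.

Definition coupling (R : realType) (m : nat)
    (P Q : set (borel_rV R m) -> \bar R)
    (gamma : probability (borel_rV R m * borel_rV R m)%type R) : Prop :=
  forall A : set (borel_rV R m), measurable A ->
    gamma (fst @^-1` A) = P A /\ gamma (snd @^-1` A) = Q A.

(* Borel probability measures on the closed set Z are encoded as Borel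
   probability measures on R^m giving mass 1 to Z; their couplings are then
   concentrated on Z x Z. *)
Definition OT (R : realType) (m : nat) (Z : set 'rV[R]_m)
    (c : 'rV[R]_m -> 'rV[R]_m -> R)
    (P Q : set (borel_rV R m) -> \bar R) : \bar R :=
  ereal_inf [set (\int[gamma]_(w in Z `*` Z) (c w.1 w.2)%:E)%E
            | gamma in [set gamma | coupling P Q gamma]].

Definition empirical (R : realType) (m N : nat) (zhat : 'I_N -> 'rV[R]_m)
    (A : set (borel_rV R m)) : \bar R :=
  ((N%:R^-1)%:E * \sum_(i < N) \d_(zhat i : borel_rV R m) A)%E.

Definition ambiguity_set (R : realType) (m N : nat) (Z : set 'rV[R]_m)
    (c : 'rV[R]_m -> 'rV[R]_m -> R) (zhat : 'I_N -> 'rV[R]_m) (rho : R) :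
    set (probability (borel_rV R m) R) :=
  [set P | P Z = 1%E /\ (OT Z c P (empirical zhat) <= rho%:E)%E].

Record regularity (R : realType) (n m N K : nat)
    (X : set 'rV[R]_n) (Z : set 'rV[R]_m)
    (c : 'rV[R]_m -> 'rV[R]_m -> R) (zhat : 'I_N -> 'rV[R]_m) (rho : R)
    (ell : 'rV[R]_n -> 'rV[R]_m -> R)
    (l : 'I_K -> 'rV[R]_n -> 'rV[R]_m -> R)
    (nrm : 'rV[R]_m -> R) (p : R) : Prop := {
  reg_X_nonempty : X !=set0 ;
  reg_X_convex : @convex_set R 'rV[R]_n X ;
  reg_inf_compact :
    exists Q0 : probability (borel_rV R m) R,
      ambiguity_set Z c zhat rho Q0 /\
      exists x0 : 'rV[R]_n,
        [/\ X x0,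
            forall t : R, compact
              [set x | X x /\ (\int[Q0]_(z in Z) (ell x z)%:E <= t%:E)%E]
          & (-oo < \int[Q0]_(z in Z) (ell x0 z)%:E)%E] ;
  reg_Z_nonempty : Z !=set0 ;
  reg_Z_closed : closed Z ;
  reg_Z_convex : @convex_set R 'rV[R]_m Z ;
  reg_K : (2 <= K)%N ;
  reg_ell : forall x z, is_max [set l k x z | k in [set: 'I_K]] (ell x z) ;
  reg_l_convex : forall k z, @convex_function R 'rV[R]_n setT (l k ^~ z) ;
  reg_l_concave : forall k x, concave_function (l k x) ;
  reg_norm : is_norm nrm ;
  reg_p : 1 <= p ;
  reg_cost_lb : forall z zh, Z z -> Z zh -> nrm (z - zh) `^ p <= c z zh ;
  reg_growth : p = 1 -> forall x, X x ->
    exists (g : R) (z0 : 'rV[R]_m) (r : R),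
      [/\ 0 < g, Z z0, 0 <= r < 1
        & forall z, Z z -> ell x z <= g * (1 + nrm (z - z0) `^ r)] }.

(* [oracle k zh u eps] is the pair of the returned point and the returned
   value. *)
Definition local_worst_case_oracle (R : realType) (m K : nat)
    (Z : set 'rV[R]_m) (c : 'rV[R]_m -> 'rV[R]_m -> R)
    (l : 'I_K -> 'rV[R]_m -> R)
    (oracle : 'I_K -> 'rV[R]_m -> R -> R -> 'rV[R]_m * R) : Prop :=
  forall k zh (u eps : R), Z zh -> 0 <= u -> 0 < eps ->
    let: (vh, Lh) := oracle k zh u eps in
    [/\ Z (zh + vh),
        c (zh + vh) zh <= u,
        Lh = l k (zh + vh)
      & forall v : 'rV[R]_m, Z (zh + v) -> c (zh + v) zh <= u ->
          l k (zh + v) - eps <= Lh].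

Definition feasible (R : realType) (m : nat) (Z : set 'rV[R]_m)
    (c : 'rV[R]_m -> 'rV[R]_m -> R) (zh : 'rV[R]_m) (a u : R) :
    set 'rV[R]_m :=
  [set v | Z (zh + v) /\ a * c (zh + v) zh <= u].

Definition Psi_values (R : realType) (m : nat) (Z : set 'rV[R]_m)
    (c : 'rV[R]_m -> 'rV[R]_m -> R) (l1 l2 : 'rV[R]_m -> R) (zh : 'rV[R]_m)
    (alpha beta : R * R) : set R :=
  [set s | exists v1 v2 : 'rV[R]_m,
    [/\ feasible Z c zh alpha.1 beta.1 v1,
        feasible Z c zh alpha.2 beta.2 v2
      & s = alpha.1 * l1 (zh + v1) + alpha.2 * l2 (zh + v2)]].

Definition is_max_supergradient_norm (R : realType) (m K : nat)
    (nrm : 'rV[R]_m -> R) (l : 'I_K -> 'rV[R]_m -> R) (z0 : 'rV[R]_m)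
    (G : R) : Prop :=
  exists2 g : 'I_K -> R,
    forall k, is_max
      [set dual_norm nrm xi | xi in superdifferential (l k) z0] (g k)
    & is_max [set g k | k in [set: 'I_K]] G.

(* Main.v *)
(** The value splits as a sum over [j = 1, 2] of budgeted maxima. If a budget
    drops from [u'] to [u], shrinking the optimal displacement [v] to
    [(u / u') v] is feasible by convexity of the cost, and by concavity of the
    loss it costs at most [a (1 - u / u') G |v|], where [a |v|^p <= u']; this is
    at most [G (u' - u)^(1/p)] because [s^p <= s] for [s] in [[0, 1]]. The
    maxima exist because real-valued concave functions on R^m have
    supergradients everywhere (Hahn-Banach), hence are upper semicontinuous. *)

Require Import Defs.
From HB Require Import structures.
From mathcomp Require Import all_boot all_order all_algebra.
From mathcomp Require Import all_classical all_reals all_analysis.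
From mathcomp Require Import lra.
Import Order.TTheory GRing.Theory Num.Theory.
Import numFieldNormedType.Exports.
Local Open Scope classical_set_scope.
Local Open Scope ring_scope.

(** * Bilinearity of the dot product and bounds in the coordinatewise maximum norm *)

Section dot_theory.
Context {R : realType} {m : nat}.
Implicit Types (u v w : 'rV[R]_m) (a : R).

Lemma dotDl u v w : dot (u + v) w = dot u w + dot v w.
Proof.
by rewrite /dot -big_split/=; apply: eq_bigr => j _; rewrite mxE mulrDl.
Qed.

Lemma dotZl a u v : dot (a *: u) v = a * dot u v.
Proof.
by rewrite /dot big_distrr/=; apply: eq_bigr => j _; rewrite mxE mulrA.
Qed.

Lemma dotC u v : dot u v = dot v u.
Proof. by apply: eq_bigr => j _; rewrite mulrC. Qed.

Lemma dotDr u v w : dot u (v + w) = dot u v + dot u w.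
Proof. by rewrite dotC dotDl !(dotC u). Qed.

Lemma dotZr a u v : dot u (a *: v) = a * dot u v.
Proof. by rewrite dotC dotZl dotC. Qed.

Lemma dot0r u : dot u 0 = 0.
Proof. by rewrite -(scale0r 0) dotZr mul0r. Qed.

Lemma dot_delta_r u j : dot u (delta_mx 0 j) = u 0 j.
Proof.
rewrite /dot (bigD1 j)//= mxE !eqxx mulr1 big1 ?addr0// => k kj.
by rewrite mxE eqxx (negbTE kj) mulr0.
Qed.

Lemma normr_coord_le u j : `|u 0 j| <= `|u|.
Proof.
rewrite [leRHS]/Num.norm /= mx_normrE.
exact: (le_bigmax 0 (fun ij : 'I_1 * 'I_m => `|u ij.1 ij.2|) (0, j)).
Qed.

Lemma normr_row_le u (B : R) :
  0 <= B -> (forall j, `|u 0 j| <= B) -> `|u| <= B.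
Proof.
move=> B0 uB; rewrite [leLHS]/Num.norm /= mx_normrE; apply/bigmax_leP.
by split=> // -[i j] _ /=; rewrite ord1.
Qed.

(** The ambient norm on rows is the maximum norm, so each of the [m] products is bounded separately;
    the crude factor [m] is harmless because only continuity and boundedness are drawn from it. *)
Lemma dot_le_normr u v : dot u v <= m%:R * `|u| * `|v|.
Proof.
rewrite -mulrA mulr_natl -[X in _ *+ X]card_ord -sumr_const ler_sum// => j _.
by rewrite (le_trans (ler_norm _))// normrM ler_pM// normr_coord_le.
Qed.

End dot_theory.

(** * Upper semicontinuous functions and attained maxima *)

Section upper_semicontinuity.
Context {R : realType}.

(* The upper level sets of [f] on [A] form a filter base; if no maximum is
   attained, near-covering compactness along it gives [y] with [f y < f y]. *)
Lemma usc_compact_max (T : topologicalType) (f : T -> R) (A : set T) :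
  compact A -> A !=set0 ->
  (forall x r, A x -> f x < r -> \forall y \near x, f y < r) ->
  exists2 x, A x & forall y, A y -> f y <= f x.
Proof.
move=> cA [a0 Aa0] usc; apply: contrapT => nomax.
have larger x : A x -> exists2 y, A y & f x < f y.
  move=> Ax; apply: contrapT => nlarger; apply: nomax; exists x => // y Ay.
  by rewrite leNgt; apply/negP => fxy; apply: nlarger; exists y.
pose F := filter_from A (fun y0 => [set y | A y /\ f y0 <= f y]).
have FF : Filter F.
  apply: filter_from_filter; first by exists a0.
  move=> x y Ax Ay; have [fxy|/ltW fyx] := leP (f x) (f y).
    exists y => // z [Az yz]; split; split=> //; exact: le_trans yz.
  by exists x => // z [Az xz]; split; split=> //; exact: le_trans xz.
have [|y Ay /(_ y)/=] :=
    (compact_near_coveringP A).1 cA T F (fun y x => f x < f y) FF.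
  move=> x /[dup] Ax /larger[y Ay fxy].
  exists ([set x' | f x' < f y], [set y' | A y' /\ f y <= f y']) => /=.
    by split; [exact: usc|exists y].
  by move=> [x' y']/= [fx' [_ fy']]; exact: lt_le_trans fy'.
by move=> /(_ (conj Ay (lexx _)) y Ay); rewrite ltxx.
Qed.

Lemma usc_closed (T : topologicalType) (f : T -> R) (r : R) :
  (forall x s, f x < s -> \forall y \near x, f y < s) ->
  closed [set x | r <= f x].
Proof.
move=> usc; rewrite -openC openE => x /= /negP; rewrite -ltNge => fxr.
by apply: filterS (usc _ _ fxr) => y fyr /=; apply/negP; rewrite -ltNge.
Qed.

(** A one-sided linear bound around the single point [x] is enough. This is the form in which
    supergradients and norms deliver upper semicontinuity. *)
Lemma usc_of_norm_bound (V : normedModType R) (f : V -> R) (x : V) (C : R) :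
  (forall y, f y <= f x + C * `|y - x|) ->
  forall r, f x < r -> \forall y \near x, f y < r.
Proof.
(* [C] may be zero or negative, so a strictly positive constant above it is used as divisor. *)
move=> fC r fxr; pose D := `|C| + 1.
have D0 : 0 < D by rewrite ltr_wpDl.
apply/nbhs_normP; exists ((r - f x) / D) => /=.
  by rewrite divr_gt0// subr_gt0.
move=> y /=; rewrite ltr_pdivlMr// => yx; apply: le_lt_trans (fC y) _.
rewrite -ltrBrDl; apply: le_lt_trans yx.
rewrite distrC mulrC ler_wpM2l//.
by rewrite (le_trans (ler_norm _))// lerDl.
Qed.

End upper_semicontinuity.

(** * Convexity and concavity with two explicit real weights *)

Lemma convex_function_le {R : realType} {E : lmodType R} {D : set E}
    {f : E -> R} (a b : R) (x y : E) :
  convex_function D f -> D x -> D y -> 0 <= a -> 0 <= b -> a + b = 1 ->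
  f (a *: x + b *: y) <= a * f x + b * f y.
Proof.
move=> cf Dx Dy a0 b0 ab1.
have a1 : a <= 1 by rewrite -ab1 lerDl.
have -> : b = 1 - a by lra.
exact: (cf (Itv01 a0 a1) _ _ (mem_set Dx) (mem_set Dy)).
Qed.

Lemma convex_set_comb {R : realType} {E : lmodType R} {D : set E}
    (a b : R) (x y : E) :
  convex_set D -> D x -> D y -> 0 <= a -> 0 <= b -> a + b = 1 ->
  D (a *: x + b *: y).
Proof.
move=> cD Dx Dy a0 b0 ab1.
have a1 : a <= 1 by rewrite -ab1 lerDl.
have -> : b = 1 - a by lra.
exact: set_mem (cD _ _ (Itv01 a0 a1) (mem_set Dx) (mem_set Dy)).
Qed.

Lemma concave_function_ge {R : realType} {m : nat} {f : 'rV[R]_m -> R}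
    (a b : R) (x y : 'rV[R]_m) :
  concave_function f -> 0 <= a -> 0 <= b -> a + b = 1 ->
  a * f x + b * f y <= f (a *: x + b *: y).
Proof.
move=> cf a0 b0 ab1.
have := convex_function_le a b x y cf I I a0 b0 ab1; lra.
Qed.

(** * Existence of supergradients and compactness of the superdifferential *)

Section supergradients.
Context {R : realType} {m : nat}.
Implicit Types (f : 'rV[R]_m -> R) (z xi : 'rV[R]_m).

(* Finite-dimensional Hahn-Banach: the supergradient is built one coordinate
   at a time, the new slope being the supremum of the slopes in the positive
   direction, which concavity places below all those in the negative one. *)
Lemma superdifferential_nonempty f z0 :
  concave_function f -> superdifferential f z0 !=set0.
Proof.
move=> cf; pose g (w : 'rV[R]_m) := f (z0 + w) - f z0.
have g0 : g 0 = 0 by rewrite /g addr0 subrr.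
have gc (a b : R) x y : 0 <= a -> 0 <= b -> a + b = 1 ->
    a * g x + b * g y <= g (a *: x + b *: y).
  move=> a0 b0 ab1.
  have := concave_function_ge a b (z0 + x) (z0 + y) cf a0 b0 ab1.
  rewrite !scalerDr addrACA -scalerDl ab1 scale1r /g.
  have -> : b = 1 - a by lra.
  lra.
(* At stage [k] the linear bound is claimed on the span of the first [k] basis vectors, which is the
   whole space for [k = m]. *)
suff /(_ m (leqnn m))[xi xiP] : forall k, (k <= m)%N -> exists xi,
    forall w : 'rV[R]_m, (forall j : 'I_m, (k <= j)%N -> w 0 j = 0) ->
      g w <= dot xi w.
  exists xi => z; have := xiP (z - z0).
  rewrite /g (addrC z0) subrK => h; rewrite addrC -lerBlDr; apply: h => j.
  by rewrite leqNgt ltn_ord.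
elim=> [_|k IH km].
  exists 0 => w w0; have -> : w = 0 by apply/rowP => j; rewrite w0// mxE.
  by rewrite g0 dot0r.
have [xi xiP] := IH (ltnW km).
pose V (w : 'rV[R]_m) := forall j : 'I_m, (k <= j)%N -> w 0 j = 0.
pose e : 'rV[R]_m := delta_mx 0 (Ordinal km).
(* The weights [s / (s + t)] and [t / (s + t)] cancel the [e]-components of the two points, so their
   combination lies in [V], where the induction hypothesis bounds [g]. *)
have slopes w w' (s t : R) : V w -> V w' -> 0 < s -> 0 < t ->
    (g (w + t *: e) - dot xi w) / t <= (dot xi w' - g (w' - s *: e)) / s.
  move=> Vw Vw' s0 t0; have st0 : 0 < s + t by rewrite addr_gt0.
  have snz := lt0r_neq0 s0; have tnz := lt0r_neq0 t0.
  have stnz := lt0r_neq0 st0.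
  have Vv : V ((s / (s + t)) *: w + (t / (s + t)) *: w').
    by move=> j kj; rewrite !mxE Vw// Vw'// !mulr0 addr0.
  have := gc (s / (s + t)) (t / (s + t)) (w + t *: e) (w' - s *: e)
    (divr_ge0 (ltW s0) (ltW st0)) (divr_ge0 (ltW t0) (ltW st0)).
  rewrite -mulrDl divff// => /(_ erefl).
  rewrite !scalerDr scalerN !scalerA addrACA.
  rewrite [t / (s + t) * s]mulrAC [t * s]mulrC [s * t / _]mulrAC subrr addr0.
  move=> /le_trans/(_ (xiP _ Vv)); rewrite dotDr !dotZr.
  rewrite ![_ / (s + t) * _]mulrAC -!mulrDl ler_pM2r ?invr_gt0// => h.
  rewrite ler_pdivrMr// mulrAC ler_pdivlMr//; lra.
pose L := [set r | exists w t, [/\ V w, 0 < t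
  & r = (g (w + t *: e) - dot xi w) / t]].
have V0 : V 0 by move=> j _; rewrite mxE.
have L0 : L !=set0 by exists ((g (0 + 1 *: e) - dot xi 0) / 1), 0, 1.
have supL w (s : R) : V w -> 0 < s -> sup L <= (dot xi w - g (w - s *: e)) / s.
  by move=> Vw s0; apply: ge_sup => // _ [w' [t [Vw' t0 ->]]]; exact: slopes.
have leL w (t : R) : V w -> 0 < t -> (g (w + t *: e) - dot xi w) / t <= sup L.
  move=> Vw t0; apply: ub_le_sup; last by exists w, t.
  (* Any slope in the direction [- e] bounds [L] from above; the one at the origin with unit step
     shows that [sup L] is a genuine supremum. *)
  exists ((dot xi 0 - g (0 - 1 *: e)) / 1) => _ [w' [t' [Vw' t'0 ->]]].
  exact: slopes.
(* This replaces coordinate [k] of [xi] by [sup L] and keeps its values on [V]. The sign of the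
   [e]-component of [z] then decides which slope bound applies. *)
exists (xi + (sup L - xi 0 (Ordinal km)) *: e) => z zP.
pose t := z 0 (Ordinal km); pose w := z - t *: e.
have Vw : V w.
  move=> j; rewrite leq_eqVlt => /orP[/eqP kj|kj].
    have -> : j = Ordinal km by apply/val_inj.
    by rewrite !mxE !eqxx mulr1 subrr.
  rewrite !mxE zP// (_ : (j == Ordinal km) = false) ?andbF ?mulr0 ?subrr//.
  by apply/eqP => jk; rewrite jk ltnn in kj.
rewrite dotDl dotZl [dot e z]dotC dot_delta_r -/t.
have zE : z = w + t *: e by rewrite subrK.
rewrite zE dotDr dotZr dot_delta_r.
have [t0|t0|t0] := ltgtP t 0.
- have := supL w (- t) Vw; rewrite oppr_gt0 => /(_ t0).
  rewrite scaleNr opprK ler_pdivlMr ?oppr_gt0//; lra.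
- by have := leL w t Vw t0; rewrite ler_pdivrMr//; lra.
- by rewrite t0 scale0r !addr0 mul0r mulr0 !addr0; exact: xiP.
Qed.

(** A supergradient at [z] gives an affine majorant touching [f] there. *)
Lemma concave_usc f z (r : R) :
  concave_function f -> f z < r -> \forall y \near z, f y < r.
Proof.
move=> cf; have [xi xiP] := superdifferential_nonempty f z cf.
apply: (@usc_of_norm_bound _ _ f z (m%:R * `|xi|)) => y.
by apply: le_trans (xiP y) _; rewrite lerD2l dot_le_normr.
Qed.

(** Each test point [z] cuts out a closed half-space of [xi] (or a trivial set when [z = z0]), and
    the superdifferential is their intersection. *)
Lemma superdifferential_closed f z0 : closed (superdifferential f z0).
Proof.
have -> : superdifferential f z0 =
    \bigcap_z [set xi | f z - f z0 <= dot xi (z - z0)].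
  apply/seteqP; split=> xi /= xiP z; first by move=> _; rewrite /= lerBlDl.
  by have := xiP z I; rewrite /= lerBlDl.
apply: closed_bigI => z _; apply: usc_closed => xi s.
apply: (@usc_of_norm_bound _ _ _ xi (m%:R * `|z - z0|)) => y.
rewrite -lerBlDl -[X in X - _]/(dot y _) -mulN1r -dotZl -dotDl scaleN1r.
by rewrite dotC dot_le_normr.
Qed.

(** Testing the supergradient inequality at [z0] plus and minus a basis vector bounds the
    corresponding coordinate from both sides. *)
Lemma superdifferential_compact f z0 : compact (superdifferential f z0).
Proof.
apply: bounded_closed_compact; last exact: superdifferential_closed.
pose h j : R :=
  `|f (z0 + delta_mx 0 j) - f z0| + `|f (z0 - delta_mx 0 j) - f z0|.
exists (\sum_j h j); split; first exact: num_real.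
move=> M hM xi xiP; apply: le_trans (ltW hM).
have h0 j : 0 <= h j by rewrite addr_ge0.
apply: normr_row_le => [|j]; first by rewrite sumr_ge0.
apply: (@le_trans _ _ (h j)); last first.
  by rewrite (bigD1 j)//= lerDl sumr_ge0.
have := xiP (z0 + delta_mx 0 j); have := xiP (z0 - delta_mx 0 j).
rewrite !(addrC z0) !addrK -scaleN1r dotZr dot_delta_r scaleN1r /h => h1 h2.
rewrite !(addrC z0) ler_norml; apply/andP; split.
  have := ler_norm (- (f (delta_mx 0 j + z0) - f z0)).
  have := normr_ge0 (f (- delta_mx 0 j + z0) - f z0).
  rewrite normrN; lra.
have := ler_norm (- (f (- delta_mx 0 j + z0) - f z0)).
have := normr_ge0 (f (delta_mx 0 j + z0) - f z0).
rewrite normrN; lra.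
Qed.

End supergradients.

(** * Equivalence of norms, the dual norm, and the constant [G] *)

Section norms.
Context {R : realType} {m : nat} {nrm : 'rV[R]_m -> R}.
Context (nrmP : is_norm nrm).
Implicit Types (z xi : 'rV[R]_m).

Lemma is_norm0 : nrm 0 = 0.
Proof. by rewrite -(scale0r 0) (is_normZ nrmP) normr0 mul0r. Qed.

Lemma is_norm_le_normr : exists C : R, forall z, nrm z <= C * `|z|.
Proof.
exists (\sum_(j < m) nrm (delta_mx 0 j)) => z.
rewrite {1}[z]row_sum_delta mulr_suml.
elim/big_ind2 : _ => [|x1 x2 y1 y2 h1 h2|j _]; first by rewrite is_norm0.
  by apply: le_trans (is_normD nrmP _ _) _; exact: lerD.
by rewrite (is_normZ nrmP) mulrC ler_wpM2l ?(is_norm_ge0 nrmP)// normr_coord_le.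
Qed.

(** On the compact unit sphere of the maximum norm, [nrm] attains a positive minimum; its inverse is
    the constant, by homogeneity. *)
Lemma normr_le_is_norm : exists2 C : R, 0 < C & forall z, `|z| <= C * nrm z.
Proof.
have [C leC] := is_norm_le_normr.
pose S := [set z : 'rV[R]_m | `|z| = 1].
(* The sphere is empty when [m = 0]; every vector is then zero and any constant works. *)
have [S0|S0] := pselect (S !=set0); last first.
  exists 1 => // z; have [->|z0] := eqVneq z 0.
    by rewrite normr0 is_norm0 mulr0.
  exfalso; apply: S0; exists (`|z|^-1 *: z).
  by rewrite /S/= normrZ normfV normr_id mulVf// normr_eq0.
have cS : compact S.
  apply: bounded_closed_compact.
    exists 1; split; first exact: num_real.
    by move=> x x1 z /= ->; exact: ltW.
  apply: (@closed_comp _ _ (fun z : 'rV[R]_m => `|z|) [set 1]).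
    by move=> z _; exact: norm_continuous.
  exact: closed_eq.
have [|z1 z1S z1P] := usc_compact_max _ (fun z => - nrm z) S cS S0.
  move=> x r _; apply: (@usc_of_norm_bound _ _ (fun z => - nrm z) x C) => y.
  have := is_normD nrmP y (x - y); rewrite addrC subrK distrC.
  by have := leC (x - y); lra.
have z1gt0 : 0 < nrm z1.
  rewrite lt_neqAle (is_norm_ge0 nrmP) andbT eq_sym; apply/eqP.
  move=> /(is_norm_eq0 nrmP) z10; move: z1S; rewrite z10 /S/= normr0 => /eqP.
  by rewrite eq_sym oner_eq0.
exists (nrm z1)^-1; first by rewrite invr_gt0.
move=> z; have [->|z0] := eqVneq z 0.
  by rewrite normr0 is_norm0 mulr0.
have zgt0 : 0 < `|z| by rewrite normr_gt0.
have := z1P (`|z|^-1 *: z); rewrite /S/= normrZ normfV normr_id.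
rewrite mulVf ?normr_eq0// lerN2 => /(_ erefl).
rewrite (is_normZ nrmP) normfV normr_id => h.
by rewrite mulrC ler_pdivlMr// mulrC -ler_pdivlMr// mulrC.
Qed.

(** Boundedness makes the [sup] in [dual_norm] a true supremum rather than a default value. *)
Lemma dual_norm_has_ubound xi :
  has_ubound [set dot xi z | z in [set z | nrm z <= 1]].
Proof.
have [C C0 leC] := normr_le_is_norm.
exists (m%:R * `|xi| * C) => _ [z /= z1 <-].
apply: le_trans (dot_le_normr _ _) _; rewrite ler_wpM2l ?mulr_ge0//.
by apply: le_trans (leC z) _; rewrite ger_pMr.
Qed.

Lemma dot_le_dual_norm xi z : dot xi z <= dual_norm nrm xi * nrm z.
Proof.
have [->|z0] := eqVneq z 0; first by rewrite dot0r is_norm0 mulr0.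
have nz : 0 < nrm z.
  rewrite lt_neqAle (is_norm_ge0 nrmP) andbT eq_sym.
  by apply: contra_neq z0 => /(is_norm_eq0 nrmP).
rewrite -ler_pdivrMr// mulrC -dotZr.
apply: (ub_le_sup (dual_norm_has_ubound xi)); exists ((nrm z)^-1 *: z) => //=.
by rewrite (is_normZ nrmP) normfV gtr0_norm// mulVf ?gt_eqF.
Qed.

Lemma dual_norm_ge0 xi : 0 <= dual_norm nrm xi.
Proof.
apply: (ub_le_sup (dual_norm_has_ubound xi)).
by exists 0; rewrite ?dot0r//= is_norm0.
Qed.

(** On the unit ball of [nrm], changing [xi] to [eta] raises the dot product by at most a constant
    times the distance between them. *)
Lemma dual_norm_usc xi (r : R) :
  dual_norm nrm xi < r -> \forall eta \near xi, dual_norm nrm eta < r.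
Proof.
have [C C0 leC] := normr_le_is_norm.
apply: (@usc_of_norm_bound _ _ _ xi (m%:R * C)) => eta.
apply: ge_sup => [|_ [z /= z1 <-]].
  by exists (dot eta 0), 0 => //=; rewrite is_norm0.
rewrite -[eta in leLHS](subrK xi) addrC dotDl lerD//.
  by apply: (ub_le_sup (dual_norm_has_ubound xi)); exists z.
apply: le_trans (dot_le_normr _ _) _.
rewrite mulrAC ler_wpM2r// ler_wpM2l//.
by apply: le_trans (leC z) _; rewrite ger_pMr.
Qed.

Lemma supergradient_norm_max (f : 'rV[R]_m -> R) z0 :
  concave_function f ->
  exists g, is_max [set dual_norm nrm xi | xi in superdifferential f z0] g.
Proof.
move=> cf.
have [|xi xiS xiP] := usc_compact_max _ (dual_norm nrm) _
    (superdifferential_compact f z0) (superdifferential_nonempty f z0 cf).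
  by move=> xi r _; exact: dual_norm_usc.
exists (dual_norm nrm xi); split; first by exists xi.
by move=> _ [eta etaS <-]; exact: xiP.
Qed.

Lemma is_max_supergradient_norm_ex (K : nat) (l : 'I_K -> 'rV[R]_m -> R) z0 :
  (0 < K)%N -> (forall k, concave_function (l k)) ->
  exists G, is_max_supergradient_norm nrm l z0 G.
Proof.
move=> K0 cl.
have [g gP] := choice (fun k => supergradient_norm_max (l k) z0 (cl k)).
case: (@arg_maxP _ _ _ (Ordinal K0) xpredT g isT) => k _ kP.
exists (g k), g => //; split; first by exists k.
by move=> _ [k' _ <-]; exact: kP.
Qed.

(** One supergradient [xi] of [l k] at [z0] suffices: the gain is at most [dot xi v], hence at most
    [dual_norm nrm xi * nrm v], and [G] dominates that dual norm. *)
Lemma concave_growth_le (K : nat) (l : 'I_K -> 'rV[R]_m -> R) z0 (G : R) k v :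
  (forall k, concave_function (l k)) ->
  is_max_supergradient_norm nrm l z0 G ->
  0 <= G /\ l k (z0 + v) - l k z0 <= G * nrm v.
Proof.
move=> cl [g gP [_ Gub]].
have [xi xiS] := superdifferential_nonempty (l k) z0 (cl k).
have xiG : dual_norm nrm xi <= G.
  apply: (@le_trans _ _ (g k)); last by apply: Gub; exists k.
  by case: (gP k) => _; apply; exists xi.
split; first exact: le_trans (dual_norm_ge0 xi) xiG.
have := xiS (z0 + v); rewrite addrAC subrr add0r lerBlDl => /le_trans; apply.
rewrite lerD2l; apply: le_trans (dot_le_dual_norm xi v) _.
by rewrite ler_wpM2r// (is_norm_ge0 nrmP).
Qed.

End norms.

(** * Maximizing one loss under a transport budget, and its dependence on the budget *)

Section budgeted_value.
Context {R : realType} {m : nat} {Z : set 'rV[R]_m}.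
Context {c : 'rV[R]_m -> 'rV[R]_m -> R} {nrm : 'rV[R]_m -> R} {p : R}.
Context (hc : transport_cost Z c) (Zclosed : closed Z).
Context (Zconvex : @convex_set R 'rV[R]_m Z).
Context (nrmP : is_norm nrm) (p1 : 1 <= p).
Context (c_ge : forall z zh, Z z -> Z zh -> nrm (z - zh) `^ p <= c z zh).
Implicit Types (l : 'rV[R]_m -> R) (zh v : 'rV[R]_m) (a u : R).

Lemma cost_sublevel_closed zh u : Z zh -> closed [set z | Z z /\ c z zh <= u].
Proof.
move=> Zzh z clz.
have Zz : Z z.
  apply: Zclosed => U zU.
  by have [y [[Zy _] Uy]] := clz U zU; exists y.
split=> //; rewrite leNgt; apply/negP => uc.
have ZZ : (Z `*` Z) (z, zh) by [].
have cu : (u%:E < (c (z, zh).1 (z, zh).2)%:E)%E by rewrite lte_fin.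
have [V + VP] := @cost_lsc _ _ _ _ hc (z, zh) u cu.
move=> nV.
(* [V] is only a relative neighbourhood; it contains the trace of a rectangle of [U1] and [U2].
   Keeping the second coordinate at [zh], a sublevel point [y] in [U1] contradicts lower
   semicontinuity. *)
have : within (Z `*` Z) (nbhs (z, zh)) V by rewrite nbhs_subspace_in.
case=> -[U1 U2] [/= zU1 zhU2] U12V.
have [y [[Zy cy] U1y]] := clz U1 zU1.
have /VP/= : V (y, zh).
  by apply: U12V => //; split=> //=; exact: nbhs_singleton.
by rewrite lte_fin ltNge cy.
Qed.

Lemma powR_le_root (t s : R) : 0 <= t -> t `^ p <= s -> t <= s `^ (1 / p).
Proof.
move=> t0 tps; have p0 : 0 < p by apply: lt_le_trans p1.
have tE : (t `^ p) `^ p^-1 = t by rewrite -powRrM divff ?gt_eqF ?powRr1.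
rewrite div1r -[leLHS]tE ge0_ler_powR ?invr_ge0 ?(ltW p0) ?nnegrE ?powR_ge0//.
exact: le_trans (powR_ge0 _ _) tps.
Qed.

(** The lower bound [c_ge] confines [z] to a ball of [nrm] around [zh] of radius [u] to the power
    [1 / p]. *)
Lemma cost_sublevel_compact zh u : Z zh -> compact [set z | Z z /\ c z zh <= u].
Proof.
move=> Zzh; apply: bounded_closed_compact; last exact: cost_sublevel_closed.
have [C C0 leC] := normr_le_is_norm nrmP.
exists (C * u `^ (1 / p) + `|zh|); split; first exact: num_real.
move=> M hM z [Zz cz]; apply: le_trans (ltW hM).
rewrite -[z](subrK zh) (le_trans (ler_normD _ _))// lerD2r.
rewrite (le_trans (leC _))// ler_wpM2l ?(ltW C0)//.
apply: powR_le_root; first exact: is_norm_ge0.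
exact: le_trans (c_ge _ _ Zz Zzh) cz.
Qed.

Lemma feasible0 zh a u : Z zh -> 0 <= u -> feasible Z c zh a u 0.
Proof. by move=> Zzh u0; split; rewrite addr0// (cost_diag hc)// mulr0. Qed.

Lemma feasible_max l zh a u : concave_function l -> Z zh -> 0 <= a -> 0 <= u ->
  exists2 v, feasible Z c zh a u v &
    forall w, feasible Z c zh a u w -> a * l (zh + w) <= a * l (zh + v).
Proof.
(* With zero weight the feasible set may be unbounded, but the objective vanishes; with positive
   weight the constraint is the cost sublevel at [u / a]. *)
move=> cl Zzh; rewrite le_eqVlt => /predU1P[<-|a0] u0.
  by exists 0 => [|w _]; [exact: feasible0|rewrite !mul0r].
have [||z [Zz cz] zP] :=
    usc_compact_max _ l _ (cost_sublevel_compact zh (u / a) Zzh).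
- by exists zh; split=> //; rewrite (cost_diag hc)// divr_ge0// ltW.
- by move=> z r _; exact: concave_usc.
exists (z - zh); rewrite /feasible/= addrC subrK.
  by split=> //; rewrite mulrC -ler_pdivlMr.
move=> w [Zw cw]; rewrite ler_wpM2l ?(ltW a0)//; apply: zP; split=> //.
by rewrite ler_pdivlMr// mulrC.
Qed.

(* Scaling [v] by [u / u'] restores feasibility by convexity of [c], and loses
   at most the fraction [1 - u / u'] of the gain of [v] over [0]. *)
Lemma feasible_shrink l zh a (G u u' : R) v :
  concave_function l -> Z zh -> 0 <= a <= 1 -> 0 <= u -> 0 <= G ->
  (forall w, l (zh + w) - l zh <= G * nrm w) ->
  feasible Z c zh a u' v ->
  exists2 w, feasible Z c zh a u w
    & a * l (zh + v) <= a * l (zh + w) + G * `|u - u'| `^ (1 / p).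
Proof.
move=> cl Zzh /andP[a0 a1] u0 G0 lG [Zv cv].
have rem0 : 0 <= G * `|u - u'| `^ (1 / p) by rewrite mulr_ge0// powR_ge0.
have [u'u|uu'] := leP u' u.
  by exists v; [split=> //; exact: le_trans u'u|rewrite lerDl].
move: a0; rewrite le_eqVlt => /predU1P[a0|a0].
  exists 0; first exact: feasible0.
  by rewrite -a0 !mul0r add0r.
have u'0 : 0 < u' by exact: le_lt_trans uu'.
pose th := u / u'.
have th0 : 0 <= th by rewrite divr_ge0// ltW.
have th1 : th < 1 by rewrite ltr_pdivrMr// mul1r.
have thE : th + (1 - th) = 1 by rewrite addrC subrK.
have th1' : 0 <= 1 - th by rewrite subr_ge0 ltW.
have thu : th * u' = u by rewrite divfK// gt_eqF.
have wE : zh + th *: v = th *: (zh + v) + (1 - th) *: zh.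
  by rewrite scalerDr addrAC -scalerDl thE scale1r.
have hconc := concave_function_ge th (1 - th) (zh + v) zh cl th0 th1' thE.
exists (th *: v).
  split; rewrite wE; first exact: convex_set_comb.
  have := convex_function_le th (1 - th) _ _
    (cost_convex hc Zzh) Zv Zzh th0 th1' thE.
  rewrite (cost_diag hc Zzh) mulr0 addr0 => h.
  rewrite -thu (le_trans (ler_wpM2l (ltW a0) h))// mulrCA.
  by rewrite ler_wpM2l.
(* As [a * (1 - th)] lies in (0, 1] and [1 <= p], it leaves the power undiminished in exponent: the
   left side is at most [(1 - th) * (a * nrm v]^ p)[, and]a * nrm v
   [^ p <= a * c (zh + v) zh <= u'], while [(1 - th) * u' = u' - u]. *)
have npow : (a * (1 - th) * nrm v) `^ p <= `|u - u'|.
  rewrite distrC gtr0_norm ?subr_gt0//.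
  have s01 : 0 < a * (1 - th) <= 1.
    by rewrite mulr_gt0 ?subr_gt0//= mulr_ile1// ?(ltW a0)// lerBlDr lerDl.
  have n0 := is_norm_ge0 nrmP v.
  apply: le_trans (ge1r_powRZ s01 n0 p1) _.
  have := c_ge _ _ Zv Zzh; rewrite addrAC subrr add0r => cn.
  have -> : u' - u = (1 - th) * u' by rewrite mulrBl mul1r thu.
  rewrite mulrAC mulrC ler_wpM2l// (le_trans _ cv)//.
  by rewrite ler_wpM2l// ltW.
have {npow} := powR_le_root _ _ _ npow.
rewrite !mulr_ge0 ?(ltW a0) ?(is_norm_ge0 nrmP)// => /(_ isT).
move=> /(ler_wpM2l G0) hroot; rewrite -lerBlDl (le_trans _ hroot)//.
rewrite mulrCA -mulrBr -[leRHS]mulrA ler_wpM2l ?(ltW a0)//.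
(* Concavity along the segment from [zh] to [zh + v] limits the loss to this fraction of the
   gain. *)
apply: (@le_trans _ _ ((1 - th) * (l (zh + v) - l zh))).
  by rewrite wE; lra.
by rewrite ler_wpM2l.
Qed.

End budgeted_value.

(** * Hölder estimate for the two-loss value under reallocation of the budget *)

Theorem lemma9 (R : realType) (n m N K : nat)
    (X : set 'rV[R]_n) (Z : set 'rV[R]_m)
    (c : 'rV[R]_m -> 'rV[R]_m -> R) (zhat : 'I_N -> 'rV[R]_m) (rho : R)
    (ell : 'rV[R]_n -> 'rV[R]_m -> R)
    (l : 'I_K -> 'rV[R]_n -> 'rV[R]_m -> R)
    (nrm : 'rV[R]_m -> R) (p : R)
    (hc : transport_cost Z c) (hzhat : forall i, Z (zhat i)) (hrho : 0 < rho)
    (hreg : regularity X Z c zhat rho ell l nrm p)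
    (x : 'rV[R]_n) (hx : X x)
    (oracle : 'I_K -> 'rV[R]_m -> R -> R -> 'rV[R]_m * R)
    (horacle : local_worst_case_oracle Z c (fun k => l k x) oracle)
    (i : 'I_N) (k1 k2 : 'I_K) (hk : (k1 < k2)%N)
    (b : R) (hb : 0 <= b)
    (alpha : R * R) (ha1 : 0 <= alpha.1) (ha2 : 0 <= alpha.2)
    (ha : alpha.1 + alpha.2 = 1) :
  exists (Psi : R * R -> R) (G : R),
    [/\ forall beta : R * R, 0 <= beta.1 -> 0 <= beta.2 ->
          is_max (Psi_values Z c (l k1 x) (l k2 x) (zhat i) alpha beta)
                 (Psi beta),
        is_max_supergradient_norm nrm (fun k => l k x) (zhat i) G
      & forall beta beta' : R * R,
          0 <= beta.1 -> 0 <= beta.2 -> 0 <= beta'.1 -> 0 <= beta'.2 ->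
          beta.1 + beta.2 = b -> beta'.1 + beta'.2 = b ->
          `|Psi beta - Psi beta'|
            <= 2 * G * `|beta.1 - beta'.1| `^ (1 / p)].
Proof.
have Zzh := hzhat i; set zh := zhat i in Zzh *.
have nrmP := reg_norm hreg; have p1 := reg_p hreg; have cge := reg_cost_lb hreg.
have Zcl := reg_Z_closed hreg; have Zcv := reg_Z_convex hreg.
have cl k : concave_function (l k x) := reg_l_concave hreg k x.
have fmax k a u := feasible_max hc Zcl nrmP p1 cge (l k x) zh a u (cl k) Zzh.
(* The sign conditions stand inside the existential so that [choice] yields a total function, with
   default value 0 on pairs having a negative budget. *)
have Psi_ex (beta : R * R) : exists M, 0 <= beta.1 -> 0 <= beta.2 ->
    is_max (Psi_values Z c (l k1 x) (l k2 x) zh alpha beta) M.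
  have [[b1 b2]|bneg] := pselect (0 <= beta.1 /\ 0 <= beta.2); last first.
    by exists 0 => b1 b2; case: bneg.
  have [v1 fv1 v1P] := fmax k1 _ _ ha1 b1.
  have [v2 fv2 v2P] := fmax k2 _ _ ha2 b2.
  exists (alpha.1 * l k1 x (zh + v1) + alpha.2 * l k2 x (zh + v2)) => _ _.
  split; first by exists v1, v2.
  by move=> _ [w1 [w2 [fw1 fw2 ->]]]; rewrite lerD ?v1P ?v2P.
have [Psi PsiP] := choice Psi_ex.
have [G GP] := is_max_supergradient_norm_ex nrmP _ (fun k => l k x) zh
  (leq_ltn_trans (leq0n _) (ltn_ord k1)) cl.
exists Psi, G; split=> //.
have G0 : 0 <= G by case: (concave_growth_le nrmP _ _ _ _ k1 0 cl GP).
have growth k w : l k x (zh + w) - l k x zh <= G * nrm w.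
  by case: (concave_growth_le nrmP _ _ _ _ k w cl GP).
have a1 : 0 <= alpha.1 <= 1 by rewrite ha1 -ha lerDl.
have a2 : 0 <= alpha.2 <= 1 by rewrite ha2 -ha lerDr.
have half (be be' : R * R) : 0 <= be.1 -> 0 <= be.2 -> 0 <= be'.1 ->
    0 <= be'.2 -> be.1 + be.2 = b -> be'.1 + be'.2 = b ->
    Psi be <= Psi be' + 2 * G * `|be.1 - be'.1| `^ (1 / p).
  move=> b1 b2 b1' b2' sb sb'.
  have [[v1 [v2 [fv1 fv2 ->]]] _] := PsiP be b1 b2.
  have [w1 fw1 w1P] := feasible_shrink hc Zcv nrmP p1 cge _ _ _ _ _ _ _
    (cl k1) Zzh a1 b1' G0 (growth k1) fv1.
  have [w2 fw2 w2P] := feasible_shrink hc Zcv nrmP p1 cge _ _ _ _ _ _ _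
    (cl k2) Zzh a2 b2' G0 (growth k2) fv2.
  have : alpha.1 * l k1 x (zh + w1) + alpha.2 * l k2 x (zh + w2) <= Psi be'.
    by case: (PsiP be' b1' b2') => _; apply; exists w1, w2.
  (* Equal totals make both budgets change by the same amount, so the two error terms coincide and
     give the factor 2. *)
  have e2 : be'.2 - be.2 = be.1 - be'.1 by lra.
  by move: w1P w2P; rewrite e2 distrC; lra.
move=> be be' b1 b2 b1' b2' sb sb'; rewrite ler_norml; apply/andP; split.
  have := half be' be b1' b2' b1 b2 sb' sb; rewrite distrC; lra.
by have := half be be' b1 b2 b1' b2' sb sb'; lra.
Qed.
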